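(* For every integer $n\ge 3$, the number $A(n)$ exists, and $A(n)\le (n-1)^2-2 = n^2-2n-1$.
   Context: For an integer $n\ge 3$, $A(n)$ is defined as the smallest positive integer $k$ such that $n+k+1$ divides $a_n(k) := n+(n+1)+\cdots+(n+k) = (k+1)n+\frac{k(k+1)}{2}$ (if such a $k$ exists). *)

(* Defs.v *)
From mathcomp Require Import all_boot.

Set Implicit Arguments.
Unset Strict Implicit.
Unset Printing Implicit Defensive.

Definition a (n k : nat) : nat := \sum_(0 <= i < k.+1) (n + i).

Lemma aE (n k : nat) : a n k = k.+1 * n + (k * k.+1) %/ 2.
Proof.
rewrite /a big_split /= sum_nat_const_nat subn0 divn2; congr (_ + _).
by rewrite bin2_sum bin2 mulnC.
Qed.

Definition A_cond (n k : nat) : bool := (0 < k) && (n + k + 1 %| a n k).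

(* A is a partial function of n, so it is given by its graph: [is_A n k] says
   that A(n) exists and equals k. *)
Definition is_A (n k : nat) : Prop :=
  A_cond n k /\ (forall j : nat, A_cond n j -> k <= j).

Lemma is_A_unique (n k l : nat) : is_A n k -> is_A n l -> k = l.
Proof.
move=> [Hk mk] [Hl ml]; apply/eqP.
by rewrite eqn_leq mk //= ml.
Qed.

(* Main.v *)
Require Import Defs.
From mathcomp Require Import all_boot.
From mathcomp Require Import zify ring.

(** Summing the progression gives 2 a_n(k) = (k + 1) (2n + k).  Modulo n + k + 1 one has
    k + 1 = - n and 2n + k = n - 1, so 2 a_n(k) = - n (n - 1).  The modulus
    n + k + 1 = n (n - 1), that is k = n^2 - 2n - 1, is therefore a natural
    candidate, and for it
      2 a_n(k) = n (n - 1) * (n - 2) (n + 1).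
    The last two factors have opposite parities, so their product is even and
    n (n - 1) divides a_n(k) itself ([A_cond_bound]).  The set of admissible k
    is thus nonempty, and its least element is at most this candidate. *)

Lemma double_a (n k : nat) : a n k * 2 = k.+1 * (2 * n + k).
Proof.
rewrite aE mulnDl divnK; last by rewrite dvdn2 oddM oddS andbN.
by ring.
Qed.

Lemma A_cond_bound (n : nat) : 3 <= n -> A_cond n ((n - 1) ^ 2 - 2).
Proof.
case: n => [|[|[|m]]] // _.
have -> : (m.+3 - 1) ^ 2 - 2 = m ^ 2 + 4 * m + 2 by nia.
(* With n = m + 3 the quotient is (n - 2) (n + 1) / 2. *)
rewrite /A_cond addn2 /=; apply/dvdnP; exists (((m + 1) * (m + 4)) %/ 2).
have even_q : 2 %| (m + 1) * (m + 4).
  by rewrite dvdn2 oddM !oddD /= addbT addbF andNb.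
apply/eqP; rewrite -(eqn_pmul2r (isT : 0 < 2)) double_a mulnAC divnK //.
by apply/eqP; ring.
Qed.

(* For 3 <= n none of the subtractions below is truncated. *)
Theorem mainTheorem1 (n : nat) (hn : 3 <= n) :
  (exists k : nat, is_A n k /\ k <= (n - 1) ^ 2 - 2) /\
  (n - 1) ^ 2 - 2 = n ^ 2 - 2 * n - 1.
Proof.
have bound := A_cond_bound n hn.
split; last by nia.
have [k Ak mink] := ex_minnP (ex_intro (A_cond n) _ bound).
by exists k; split; [split | exact: mink].
Qed.
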